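(* Let $A\in\mathbb{R}^{m\times n}$, $b\in\mathbb{R}^m$, $c\in\mathbb{R}^n$, and $X\subseteq\mathbb{Z}^n$. Suppose that $n\leq 2$. If the integer program of minimizing $c\cdot x$ subject to $Ax\geq b$ and $x\in X$ is feasible (i.e., there exists $x\in X$ with $Ax\geq b$), then $v^L=\bar v^\star$.
   Context: Inequalities between vectors are componentwise, $\mathbb{R}_+^m$ is the set of vectors of $\mathbb{R}^m$ with nonnegative entries, and $\cdot$ is the standard inner product. $\operatorname{conv}(X)$ is the convex hull of $X$ and $\overline{\operatorname{conv}}(X)$ is the closure of $\operatorname{conv}(X)$. The dual function is $$\mathcal{G}(\lambda)=\inf\{c\cdot x+\lambda\cdot(b-Ax)\colon x\in X\}\in\mathbb{R}\cup\{\pm\infty\},\qquad \lambda\in\mathbb{R}_+^m,$$ and $v^L=\sup\{\mathcal{G}(\lambda)\colon\lambda\in\mathbb{R}_+^m\}$. Further, $\bar v^\star=\inf\{c\cdot x\colon Ax\geq b,\ x\in\overline{\operatorname{conv}}(X)\}$. Infima and suprema are taken in the extended reals; both sides of the claimed equality may be $-\infty$. *)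

(* Defs.v *)
From HB Require Import structures.
From mathcomp Require Export all_boot all_order all_algebra.
From mathcomp Require Export all_classical all_reals ereal topology normedtype.
Export numFieldNormedType.Exports.

Set Implicit Arguments.
Unset Strict Implicit.
Unset Printing Implicit Defensive.

Import Order.TTheory GRing.Theory Num.Theory.
Local Open Scope classical_set_scope.
Local Open Scope ring_scope.

Definition dotv (R : realType) (n : nat) (u v : 'cV[R]_n) : R :=
  \sum_i u i ord0 * v i ord0.

Definition lev (R : realType) (n : nat) (u v : 'cV[R]_n) : Prop :=
  forall i, u i ord0 <= v i ord0.

Definition conv_hull (R : realType) (E : lmodType R) (X : set E) : set E :=
  [set x | exists (k : nat) (w : 'I_k -> R) (p : 'I_k -> E),
    [/\ forall i, 0 <= w i,
        \sum_i w i = 1,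
        forall i, X (p i)
      & x = \sum_i w i *: p i]].

Definition feasible (R : realType) (m n : nat)
    (A : 'M[R]_(m, n)) (b : 'cV[R]_m) (X : set 'cV[R]_n) : Prop :=
  exists2 x, X x & lev b (A *m x).

Definition dual_fun (R : realType) (m n : nat)
    (A : 'M[R]_(m, n)) (b : 'cV[R]_m) (c : 'cV[R]_n) (X : set 'cV[R]_n)
    (l : 'cV[R]_m) : \bar R :=
  ereal_inf [set (dotv c x + dotv l (b - A *m x))%:E | x in X].

Definition lagrangian_dual_value (R : realType) (m n : nat)
    (A : 'M[R]_(m, n)) (b : 'cV[R]_m) (c : 'cV[R]_n) (X : set 'cV[R]_n) : \bar R :=
  ereal_sup [set dual_fun A b c X l | l in [set l : 'cV[R]_m | lev 0 l]].

Definition closed_hull_value (R : realType) (m n : nat)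
    (A : 'M[R]_(m, n)) (b : 'cV[R]_m) (c : 'cV[R]_n) (X : set 'cV[R]_n) : \bar R :=
  ereal_inf [set (dotv c x)%:E | x in
    [set x : 'cV[R]_n | lev b (A *m x) /\ closure (conv_hull X) x]].

(* Main.v *)
(** Weak duality holds because an affine inequality valid on [X] passes to the
closed convex hull. For the converse let [al] lie strictly below the closed hull
value and put [F = {x | A x >= b, c.x <= al}], a polyhedron disjoint from
[K = cl conv X]; a multiplier certifying [al] is wanted. If [F] is empty, Farkas'
lemma gives it, since feasibility forces a positive weight on [c.x <= al].
Otherwise a line [h.x = be] separates [F] from [K]; Farkas' lemma writes
[h.x <= be] as a consequence of the rows of [F], and if the row [c.x <= al] has
positive weight we are done. If it has weight zero, all feasible points of [K] lie
on the line. Either no point of [F] does, and Farkas' lemma applies again with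
the extra row [h.x >= be], or some feasible [y] on the line has [c.y = al]. A line
[g] strictly separating [y] from [K] then satisfies, after scaling,
[g = c + ga h], because [g - c] and [h] both vanish along the line and the
dimension is two; as [h.x >= be] on [K], adding [max ga 0] times the multiplier
of [h] certifies [al]. *)

Require Import Defs.
From mathcomp Require Import ring lra.

Set Implicit Arguments.
Unset Strict Implicit.
Unset Printing Implicit Defensive.

Import Order.TTheory GRing.Theory Num.Theory.
Local Open Scope classical_set_scope.
Local Open Scope ring_scope.

(** * Farkas' lemma for linear and affine forms *)

(* Induction on the number of forms (Bartl): a point [z] violating the conclusion
   for all forms but the first is used to project the first form away. *)
Lemma farkas (R : realType) (V : lmodType R) (m : nat) (a : 'I_m -> V -> R)
    (g : V -> R) (ascalar : forall i, scalar (a i)) (gscalar : scalar g) :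
  (forall x, (forall i, 0 <= a i x) -> 0 <= g x) ->
  exists2 l : 'I_m -> R, forall i, 0 <= l i &
    forall x, g x = \sum_i l i * a i x.
Proof.
elim: m => [|m IH] in a g ascalar gscalar *.
  move=> H; exists (fun=> 0) => // x; rewrite big_ord0.
  have g0 y : 0 <= g y by apply: H => -[].
  have gN : g (- x) = - g x.
    have := gscalar (-1) x (- x); have := gscalar 0 x (- x).
    have := gscalar 1 0 0; rewrite !scaler0 addr0 scale0r add0r scaleN1r.
    have := gscalar (-1) x 0; rewrite scaleN1r addr0.
    lra.
  by have := g0 x; have := g0 (- x); lra.
move=> H.
pose a' i := a (lift ord0 i); pose u := a ord0.
have uS : scalar u by exact: ascalar.
have a'S i : scalar (a' i) by exact: ascalar.
have sZ (f : V -> R) : scalar f -> forall k x, f (k *: x) = k * f x.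
  move=> fS k x; have := fS 1 0 0; have := fS k x 0.
  by rewrite scaler0 !addr0; lra.
case: (pselect (forall x, (forall i, 0 <= a' i x) -> 0 <= g x)) => [H'|].
  have [l l0 gl] := IH a' g a'S gscalar H'.
  exists (fun i => oapp l 0 (unlift ord0 i)).
    by move=> i; case: unlift => /=.
  move=> x; rewrite big_ord_recl unlift_none /= mul0r add0r gl.
  by apply: eq_bigr => i _; rewrite liftK.
move=> /existsNP[x0 /not_implyP[ax0 /negP]]; rewrite -ltNge => gx0.
have ux0 : u x0 < 0.
  rewrite ltNge; apply/negP => ux0; suff : 0 <= g x0 by lra.
  apply: H => i; case: (unliftP ord0 i) => [j ->|->//]; exact: ax0.
(* Dividing by the negative number [u x0] reverses signs: [a' i z <= 0 < g z], while [u z = 1]. *)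
pose z := (u x0)^-1 *: x0.
have uz : u z = 1 by rewrite /z sZ // mulVf // lt_eqF.
have iu : (u x0)^-1 < 0 by rewrite invr_lt0.
have gz : 0 < g z by rewrite /z sZ //; nra.
have az i : a' i z <= 0 by rewrite /z sZ //; have := ax0 i; nra.
(* [f x - f z * u x] is [f] at the projection of [x] onto the kernel of [u] along [z], where the
   first constraint holds with equality. *)
have [|||l l0 gl] := IH (fun i x => a' i x - a' i z * u x)
  (fun x => g x - g z * u x).
- by move=> i k x y; rewrite (a'S i) uS; ring.
- by move=> k x y; rewrite gscalar uS; ring.
- move=> x ax; have e (f : V -> R) : scalar f -> f x - f z * u x = f (- u x *: z + x).
    by move=> ->; ring.
  rewrite e //; apply: H => i; case: (unliftP ord0 i) => [j ->|->].
    by rewrite -/(a' j) -e.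
  by rewrite -/u uS uz; lra.
(* Collecting the terms in [u x] gives the weight of the first form; the signs at [z] make it
   nonnegative. *)
exists (fun i => oapp l (g z - \sum_i l i * a' i z) (unlift ord0 i)).
  move=> i; case: unlift => //=; rewrite subr_ge0 (le_trans _ (ltW gz))//.
  by apply: sumr_le0 => j _; rewrite mulr_ge0_le0.
move=> x; rewrite big_ord_recl unlift_none /= -/u.
rewrite [X in _ = _ + X](eq_bigr (fun i => l i * a' i x)); last first.
  by move=> i _; rewrite liftK.
have := gl x; suff -> : \sum_i l i * (a' i x - a' i z * u x) =
  \sum_i l i * a' i x - (\sum_i l i * a' i z) * u x by lra.
by rewrite mulr_suml -sumrB; apply: eq_bigr => i _; ring.
Qed.

(** A triple holds two coefficients and a constant term, so [(f.1, 0)] is the linear part of [f]. *)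
Definition aff (R : realType) (f : R * R * R) (x y : R) : R :=
  f.1.1 * x + f.1.2 * y + f.2.

(** Homogenise with a third coordinate [t] and the extra row [t >= 0]. The first hypothesis covers
    [t > 0] after division by [t], the second covers [t = 0]; the weight of the extra row becomes
    the slack in the conclusion. *)
Lemma affine_farkas (R : realType) (m : nat) (F : 'I_m -> R * R * R)
    (G : R * R * R) :
  (forall x y, (forall i, 0 <= aff (F i) x y) -> 0 <= aff G x y) ->
  (forall x y, (forall i, 0 <= aff ((F i).1, 0) x y) -> 0 <= aff (G.1, 0) x y) ->
  exists2 l : 'I_m -> R, forall i, 0 <= l i &
    forall x y, \sum_i l i * aff (F i) x y <= aff G x y.
Proof.
move=> HG H0.
pose hom (f : R * R * R) (v : R^o * R^o * R^o) : R :=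
  f.1.1 * v.1.1 + f.1.2 * v.1.2 + f.2 * v.2.
have homS f : scalar (hom f).
  by move=> k [[x y] z] [[x' y'] z']; rewrite /hom /= /GRing.scale /=; ring.
pose F' (i : 'I_m.+1) := oapp F (0, 0, 1) (unlift ord0 i).
have [i|||l l0 gl] := @farkas R _ m.+1 (fun i => hom (F' i)) (hom G).
- exact: homS.
- exact: homS.
- move=> [[x y] t] H.
  have : 0 <= t by have := H ord0; rewrite /F' unlift_none /hom /=; lra.
  have {}H i : 0 <= hom (F i) (x, y, t) by have := H (lift ord0 i); rewrite /F' liftK.
  rewrite le_eqVlt => /predU1P[t0|t0].
    have := H0 x y; rewrite /aff /hom /= -t0 mulr0; apply => i.
    by have := H i; rewrite /hom /= -t0 mulr0.
  have e f : hom f (x, y, t) = t * aff f (x / t) (y / t).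
    by rewrite /hom /aff /=; field; rewrite gt_eqF.
  rewrite e pmulr_rge0 //; apply: HG => i.
  by rewrite -(pmulr_rge0 _ t0) -e.
exists (fun i => l (lift ord0 i)) => // x y.
have homE f : hom f (x, y, 1) = aff f x y by rewrite /hom /aff /= mulr1.
have := gl (x, y, 1); rewrite homE => ->.
rewrite big_ord_recl /F' unlift_none /= homE.
rewrite [X in _ <= _ + X](eq_bigr (fun i => l (lift ord0 i) * aff (F i) x y)).
  by rewrite lerDr /aff /= !mul0r !add0r mulr1.
by move=> i _; rewrite liftK homE.
Qed.

(** * Separation of a convex planar set from the origin *)

(* A point of [C] left of the vertical axis and one right of it produce a point of
   [C] on the axis; its height being positive compares their slopes. *)
Lemma convex_separation_above (R : realType) (C : set (R * R)) :
  (forall p q t, C p -> C q -> 0 <= t <= 1 ->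
     C (t * p.1 + (1 - t) * q.1, t * p.2 + (1 - t) * q.2)) ->
  (forall y, C (0, y) -> 0 < y) ->
  exists h1 h2 : R, (h1 != 0) || (h2 != 0) /\
    forall p, C p -> 0 <= h1 * p.1 + h2 * p.2.
Proof.
move=> Cconv Cpos.
case: (pselect (exists2 p, C p & 0 < p.1)) => [[p0 Cp0 p0_gt0]|noP]; last first.
  exists (-1), 0; split; first by rewrite oppr_eq0 oner_eq0.
  move=> p Cp; rewrite mulN1r mul0r addr0 oppr_ge0 leNgt.
  by apply/negP => pgt; apply: noP; exists p.
case: (pselect (exists2 q, C q & q.1 < 0)) => [[q0 Cq0 q0_lt0]|noQ]; last first.
  exists 1, 0; split; first by rewrite oner_eq0.
  move=> p Cp; rewrite mul1r mul0r addr0 leNgt.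
  by apply/negP => plt; apply: noQ; exists p.
have cross p q : C p -> C q -> 0 < p.1 -> q.1 < 0 -> q.2 / q.1 <= p.2 / p.1.
  move=> Cp Cq p_gt0 q_lt0; have d_gt0 : 0 < p.1 - q.1 by lra.
  have Cpq := Cconv p q (- q.1 / (p.1 - q.1)) Cp Cq.
  have /Cpq : 0 <= - q.1 / (p.1 - q.1) <= 1.
    by rewrite divr_ge0 ?ler_pdivrMr //=; lra.
  set u := (X in C (X, _)); set v := (X in C (_, X)).
  have -> : u = 0 by rewrite /u; field; rewrite gt_eqF.
  have -> : v = (p.1 * q.2 - q.1 * p.2) / (p.1 - q.1).
    by rewrite /v; field; rewrite gt_eqF.
  move=> /Cpos; rewrite pmulr_lgt0 ?invr_gt0 // => h.
  rewrite ler_pdivlMr // mulrAC ler_ndivrMr //; lra.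
pose S := [set q.2 / q.1 | q in [set q | C q /\ q.1 < 0]].
have S0 : S !=set0 by exists (q0.2 / q0.1); exists q0.
have Sub p : C p -> 0 < p.1 -> ubound S (p.2 / p.1).
  by move=> Cp p_gt0 _ [q [Cq q_lt0] <-]; exact: cross.
have hS : has_sup S by split => //; exists (p0.2 / p0.1); exact: Sub.
(* The line through the origin has slope [sup S], the supremum of the slopes on the left, which by
   [cross] is at most every slope on the right. *)
exists (- sup S), 1; split; first by rewrite oner_eq0 orbT.
move=> p Cp; rewrite mul1r; have [p_lt0|p_gt0|p0E] := ltgtP p.1 0.
- have : p.2 / p.1 <= sup S by apply: ub_le_sup; [exact: hS.2 | exists p].
  by rewrite ler_ndivrMr //; lra.
- have : sup S <= p.2 / p.1 by apply: ge_sup => //; exact: Sub.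
  by rewrite ler_pdivlMr //; lra.
- by rewrite p0E mulr0 add0r ltW // Cpos // -p0E -surjective_pairing.
Qed.

(** By convexity, the points of [C] on the vertical axis all lie on the same side of the origin; if
    that side is below, reflect in the horizontal axis. *)
Lemma convex_weak_separation (R : realType) (C : set (R * R)) :
  (forall p q t, C p -> C q -> 0 <= t <= 1 ->
     C (t * p.1 + (1 - t) * q.1, t * p.2 + (1 - t) * q.2)) ->
  ~ C (0, 0) ->
  exists h1 h2 : R, (h1 != 0) || (h2 != 0) /\
    forall p, C p -> 0 <= h1 * p.1 + h2 * p.2.
Proof.
move=> Cconv C0.
case: (pselect (forall y, C (0, y) -> 0 < y)) => [|/existsNP[y0 /not_implyP[Cy0]]].
  exact: convex_separation_above.
move=> /negP; rewrite -leNgt => y0_le0.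
have [||h1 [h2 [hneq0 hC]]] :=
    @convex_separation_above R [set p | C (p.1, - p.2)].
- move=> p q t Cp Cq t01 /=; have := Cconv _ _ t Cp Cq t01 => /=.
  by rewrite !mulrN opprD.
- move=> y /= Cy; rewrite ltNge; apply/negP => y_le0.
  have [y0E|y0_neq0] := eqVneq y0 0; first by rewrite y0E in Cy0.
  have d_gt0 : 0 < - y - y0 by lra.
  have t01 : 0 <= - y / (- y - y0) <= 1.
    by rewrite divr_ge0 ?ler_pdivrMr //=; lra.
  apply: C0; have := Cconv _ _ _ Cy0 Cy t01 => /=.
  by congr (C (_, _)); field; rewrite gt_eqF.
- exists h1, (- h2); split; first by rewrite oppr_eq0.
  move=> p Cp; rewrite mulNr -mulrN; apply: (hC (p.1, - p.2)) => /=.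
  by rewrite opprK -surjective_pairing.
Qed.

(** * Affine Farkas certificates for infeasible and feasible systems *)

(** An infeasible system vacuously implies [0 <= -1], and the linear part of the constant [-1] is
    zero. *)
Lemma affine_farkas_infeasible (R : realType) (m : nat) (F : 'I_m -> R * R * R) :
  ~ (exists x y, forall i, 0 <= aff (F i) x y) ->
  exists2 l : 'I_m -> R, forall i, 0 <= l i &
    forall x y, \sum_i l i * aff (F i) x y <= -1.
Proof.
move=> noF; have [||l l0 lF] := @affine_farkas R m F (0, 0, -1).
- by move=> x y Fxy; case: noF; exists x, y.
- by move=> x y _; rewrite /aff /= !mul0r !addr0.
- by exists l => // x y; rewrite (le_trans (lF x y))// /aff /= !mul0r !add0r.
Qed.

(** A feasible point yields the condition on linear parts: if [G] decreased along a recession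
    direction of the system, the ray from that point would reach a feasible point with [G]
    negative. *)
Lemma affine_farkas_feasible (R : realType) (m : nat) (F : 'I_m -> R * R * R)
    (G : R * R * R) (x0 y0 : R) (Fx0 : forall i, 0 <= aff (F i) x0 y0) :
  (forall x y, (forall i, 0 <= aff (F i) x y) -> 0 <= aff G x y) ->
  exists2 l : 'I_m -> R, forall i, 0 <= l i &
    forall x y, \sum_i l i * aff (F i) x y <= aff G x y.
Proof.
move=> FG; apply: affine_farkas => // u v Fuv.
have ray f t : aff f (x0 + t * u) (y0 + t * v) =
    aff f x0 y0 + t * aff (f.1, 0) u v by rewrite /aff /=; ring.
rewrite leNgt; apply/negP => Guv.
have Gx0 : 0 <= aff G x0 y0 by exact: FG.
have Guv0 : 0 < - aff (G.1, 0) u v by rewrite oppr_gt0.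
pose t := (aff G x0 y0 + 1) / (- aff (G.1, 0) u v).
have t0 : 0 <= t by rewrite divr_ge0 ?ltW //; lra.
have : 0 <= aff G (x0 + t * u) (y0 + t * v).
  by apply: FG => i; rewrite ray addr_ge0 // mulr_ge0.
rewrite ray (_ : t * _ = - (aff G x0 y0 + 1)); first by lra.
by rewrite /t; field; rewrite lt_eqF.
Qed.

Definition row_cons (R : realType) (m : nat) (g : R * R * R)
    (F : 'I_m -> R * R * R) (i : 'I_m.+1) : R * R * R :=
  oapp F g (unlift ord0 i).

Lemma row_cons_ge0 (R : realType) (m : nat) (g : R * R * R)
    (F : 'I_m -> R * R * R) (x y : R) :
  (forall i, 0 <= aff (row_cons g F i) x y) <->
  0 <= aff g x y /\ (forall i, 0 <= aff (F i) x y).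
Proof.
split=> [H|[Pg PF] i]; last by rewrite /row_cons; case: unlift => [j|] /=.
split=> [|i]; first by have := H ord0; rewrite /row_cons unlift_none.
by have := H (lift ord0 i); rewrite /row_cons liftK.
Qed.

Lemma sum_row_cons (R : realType) (m : nat) (l : 'I_m.+1 -> R) (g : R * R * R)
    (F : 'I_m -> R * R * R) (x y : R) :
  \sum_i l i * aff (row_cons g F i) x y =
  l ord0 * aff g x y + \sum_i l (lift ord0 i) * aff (F i) x y.
Proof.
rewrite big_ord_recl /row_cons unlift_none; congr (_ + _).
by apply: eq_bigr => i _; rewrite liftK.
Qed.

(** * Duality over a convex set in the plane *)

Section planar_duality.
Variables (R : realType) (m : nat) (F : 'I_m -> R * R * R) (o : R * R * R).
Variables (C : set (R * R)) (x0 y0 : R).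
Hypothesis Cconv : forall p q t, C p -> C q -> 0 <= t <= 1 ->
  C (t * p.1 + (1 - t) * q.1, t * p.2 + (1 - t) * q.2).
Hypotheses (C0 : C (x0, y0)) (F0 : forall i, 0 <= aff (F i) x0 y0).

Let multiplier := exists2 l : 'I_m -> R, forall i, 0 <= l i &
  forall p, C p -> \sum_i l i * aff (F i) p.1 p.2 <= aff o p.1 p.2.

Lemma aff_convex (f : R * R * R) (t x y x' y' : R) :
  aff f (t * x + (1 - t) * x') (t * y + (1 - t) * y') =
  t * aff f x y + (1 - t) * aff f x' y'.
Proof. by rewrite /aff; ring. Qed.

Lemma multiplier_rescale (l : 'I_m -> R) (mu : R) :
  (forall i, 0 <= l i) -> 0 < mu ->
  (forall p, C p ->
     \sum_i l i * aff (F i) p.1 p.2 <= mu * aff o p.1 p.2) -> multiplier.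
Proof.
move=> l0 mu0 H; exists (fun i => l i / mu) => [i|p Cp].
  by rewrite divr_ge0 // ltW.
under eq_bigr do rewrite mulrAC.
by rewrite -mulr_suml ler_pdivrMr // [leRHS]mulrC H.
Qed.

(** The weight of [o] in the infeasibility certificate is positive: otherwise, at the feasible point
    [(x0, y0)], where [g] vanishes, a nonnegative sum would be at most [-1]. On [C] the term in [g]
    has the right sign to be dropped. *)
Lemma multiplier_infeasible (g : R * R * R) :
  (forall p, C p -> 0 <= aff g p.1 p.2) -> aff g x0 y0 = 0 ->
  ~ (exists x y, [/\ 0 <= aff g x y, aff o x y <= 0 &
       forall i, 0 <= aff (F i) x y]) -> multiplier.
Proof.
move=> gC g0 noF.
have [[x [y]]|l l0 lF] := @affine_farkas_infeasible R m.+2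
    (row_cons g (row_cons (- o.1.1, - o.1.2, - o.2) F)).
  move=> /row_cons_ge0[gxy /row_cons_ge0[oxy Fxy]]; apply: noF.
  by exists x, y; split => //; move: oxy; rewrite /aff /=; lra.
have {}lF x y : \sum_i l (lift ord0 (lift ord0 i)) * aff (F i) x y <=
    l (lift ord0 ord0) * aff o x y - l ord0 * aff g x y - 1.
  by have := lF x y; rewrite !sum_row_cons /aff /=; lra.
have mu0 : 0 < l (lift ord0 ord0).
  rewrite lt_neqAle l0 andbT eq_sym; apply/eqP => mu0.
  have := lF x0 y0; rewrite mu0 g0 mul0r mulr0.
  have : 0 <= \sum_i l (lift ord0 (lift ord0 i)) * aff (F i) x0 y0.
    by apply: sumr_ge0 => i _; rewrite mulr_ge0.
  by lra.
apply: (@multiplier_rescale (fun i => l (lift ord0 (lift ord0 i))) _ _ mu0) => // p Cp.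
have := lF p.1 p.2; have : 0 <= l ord0 * aff g p.1 p.2 by rewrite mulr_ge0 ?gC.
by lra.
Qed.

(** [C] need not be closed; in the maximum norm this keeps such points outside its closure. *)
Hypothesis Fdisj : forall x y, (forall i, 0 <= aff (F i) x y) ->
  aff o x y <= 0 ->
  exists2 r : R, 0 < r & forall p, C p -> r <= `|p.1 - x| \/ r <= `|p.2 - y|.

(** Weak separation is applied to [C] thickened by an open square of half-side [r], which leaves
    room for a strict inequality. *)
Lemma separate_point (x y : R) :
  (forall i, 0 <= aff (F i) x y) -> aff o x y <= 0 ->
  exists g1 g2 : R, forall p, C p -> 0 < g1 * (p.1 - x) + g2 * (p.2 - y).
Proof.
move=> Fxy oxy; have [r r0 Cr] := Fdisj Fxy oxy.
pose D : set (R * R) := [set d | exists p u v, [/\ C p, `|u| < r, `|v| < r &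
  d = (p.1 - x - u, p.2 - y - v)]].
have comb_lt (t u v : R) : 0 <= t <= 1 -> u < r -> v < r -> t * u + (1 - t) * v < r.
  by move=> /andP[t0 t1] ur vr; case: (leP u v) => uv; nra.
have combr (t u v : R) : 0 <= t <= 1 -> `|u| < r -> `|v| < r ->
    `|t * u + (1 - t) * v| < r.
  move=> t01; rewrite !ltr_norml => /andP[u1 u2] /andP[v1 v2].
  rewrite comb_lt // andbT ltrNl opprD -!mulrN.
  by apply: comb_lt => //; rewrite ltrNl.
have [||g1 [g2 [gneq0 gD]]] := @convex_weak_separation R D.
- move=> _ _ t [p [u [v [Cp ur vr ->]]]] [q [u' [v' [Cq u'r v'r ->]]]] t01 /=.
  eexists; exists (t * u + (1 - t) * u'), (t * v + (1 - t) * v').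
  split; [exact: (Cconv Cp Cq t01) | exact: combr | exact: combr | ].
  by congr (_, _) => /=; ring.
- move=> [p [u [v [Cp ur vr [e1 e2]]]]].
  have {}e1 : p.1 - x = u by lra.
  have {}e2 : p.2 - y = v by lra.
  by case: (Cr _ Cp); rewrite ?e1 ?e2 leNgt ?ur ?vr.
exists g1, g2 => p Cp.
have sgr (z : R) : `|r / 2 * Num.sg z| < r.
  rewrite normrM (ger0_norm (_ : 0 <= r / 2)); last by lra.
  have : `|Num.sg z| <= 1 by rewrite normr_sg; case: (z == 0).
  by have := normr_ge0 (Num.sg z); nra.
(* This shift within the square lowers the form by [r / 2 * (|g1| + |g2|)], which is positive. *)
have := gD (p.1 - x - r / 2 * Num.sg g1, p.2 - y - r / 2 * Num.sg g2).
move=> /(_ _)/= H.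
have {}H : 0 <= g1 * (p.1 - x - r / 2 * Num.sg g1) +
    g2 * (p.2 - y - r / 2 * Num.sg g2).
  by apply: H; exists p, (r / 2 * Num.sg g1), (r / 2 * Num.sg g2).
have e (z : R) : z * Num.sg z = `|z| by rewrite mulrC -normrEsg.
have : 0 < r / 2 * (`|g1| + `|g2|).
  apply: mulr_gt0; first by lra.
  by case/orP: gneq0 => gn; rewrite -normr_gt0 in gn;
    have := normr_ge0 g1; have := normr_ge0 g2; lra.
by rewrite -!e; lra.
Qed.

Lemma planar_duality : multiplier.
Proof.
have [noF|] := pselect (~ exists x y, aff o x y <= 0 /\
  forall i, 0 <= aff (F i) x y).
  apply: (@multiplier_infeasible (0, 0, 0)).
  - by move=> p _; rewrite /aff /= !mul0r !addr0.
  - by rewrite /aff /= !mul0r !addr0.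
  - by move=> [x [y [_ oxy Fxy]]]; apply: noF; exists x, y.
move=> /contrapT[xF [yF [oF FF]]].
(* [D] is the Minkowski difference of [C] and the polyhedron; separating it from the origin
   separates the two sets. *)
pose D : set (R * R) := [set d | exists p x y, [/\ C p, aff o x y <= 0,
  forall i, 0 <= aff (F i) x y & d = (p.1 - x, p.2 - y)]].
have [||h1 [h2 [hneq0 hD]]] := @convex_weak_separation R D.
- move=> _ _ t [p [x [y [Cp oxy Fxy ->]]]] [q [x' [y' [Cq oxy' Fxy' ->]]]] t01 /=.
  eexists; exists (t * x + (1 - t) * x'), (t * y + (1 - t) * y').
  case/andP: (t01) => t0 t1.
  split; [exact: (Cconv Cp Cq t01) | | move=> i | ].
  + by rewrite aff_convex; nra.
  + by rewrite aff_convex; have := Fxy i; have := Fxy' i; nra.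
  + by congr (_, _) => /=; ring.
- move=> [p [x [y [Cp oxy Fxy [e1 e2]]]]].
  have [r r0 /(_ _ Cp)] := Fdisj Fxy oxy.
  by rewrite -e1 -e2 normr0; case; lra.
have hC p x y : C p -> aff o x y <= 0 -> (forall i, 0 <= aff (F i) x y) ->
    h1 * x + h2 * y <= h1 * p.1 + h2 * p.2.
  move=> Cp oxy Fxy; have := hD (p.1 - x, p.2 - y) => /= H.
  suff : 0 <= h1 * (p.1 - x) + h2 * (p.2 - y) by lra.
  by apply: H; exists p, x, y.
pose S : set R := [set z | exists x y, [/\ aff o x y <= 0,
  forall i, 0 <= aff (F i) x y & z = h1 * x + h2 * y]].
have S0 : S !=set0 by exists (h1 * xF + h2 * yF), xF, yF.
have Sub p : C p -> ubound S (h1 * p.1 + h2 * p.2).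
  by move=> Cp _ [x [y [oxy Fxy ->]]]; exact: hC.
pose be := sup S.
have beC p : C p -> be <= h1 * p.1 + h2 * p.2.
  by move=> Cp; apply: ge_sup => //; exact: Sub.
have beF x y : aff o x y <= 0 -> (forall i, 0 <= aff (F i) x y) ->
    h1 * x + h2 * y <= be.
  move=> oxy Fxy; apply: ub_le_sup; last by exists x, y.
  by exists (h1 * x0 + h2 * y0); exact: Sub C0.
(* Certificate for [h <= be] on the polyhedron; its weight [mu] on the row [o <= 0] decides the
   case. *)
have [||l l0 lF] := @affine_farkas_feasible R m.+1
    (row_cons (- o.1.1, - o.1.2, - o.2) F) (- h1, - h2, be) xF yF.
- by apply/row_cons_ge0; split => //;
    move: oF; rewrite /aff /=; lra.
- move=> x y /row_cons_ge0[oxy Fxy].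
  have : h1 * x + h2 * y <= be by apply: beF => //; move: oxy; rewrite /aff /=; lra.
  by rewrite /aff /=; lra.
pose mu := l ord0; pose la i := l (lift ord0 i).
have {}lF x y : \sum_i la i * aff (F i) x y <=
    mu * aff o x y + (be - (h1 * x + h2 * y)).
  by have := lF x y; rewrite sum_row_cons /aff /= -/mu; lra.
have [mu0|mu0|mu0] := ltgtP mu 0; first by have := l0 ord0; rewrite -/mu; lra.
  apply: (multiplier_rescale _ mu0 (l := la)) => [i|p Cp]; first exact: l0.
  by have := lF p.1 p.2; have := beC _ Cp; lra.
have {mu0}lF x y : \sum_i la i * aff (F i) x y <= be - (h1 * x + h2 * y).
  by have := lF x y; rewrite mu0; lra.
have laF x y : (forall i, 0 <= aff (F i) x y) ->
    0 <= \sum_i la i * aff (F i) x y.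
  by move=> Fxy; apply: sumr_ge0 => i _; rewrite mulr_ge0 // l0.
have hx0 : h1 * x0 + h2 * y0 = be.
  by have := lF x0 y0; have := laF _ _ F0; have := beC _ C0 => /=; lra.
have [noF|] := pselect (~ exists x y, [/\ 0 <= aff (h1, h2, - be) x y,
    aff o x y <= 0 & forall i, 0 <= aff (F i) x y]).
  apply: multiplier_infeasible noF; last by rewrite /aff /=; lra.
  by move=> p Cp; have := beC _ Cp; rewrite /aff /=; lra.
move=> /contrapT[x1 [y1 [hx1 ox1 F1]]].
have {}hx1 : h1 * x1 + h2 * y1 = be.
  by have := beF _ _ ox1 F1; move: hx1; rewrite /aff /=; lra.
have ox0 : 0 < aff o x0 y0.
  rewrite ltNge; apply/negP => /(Fdisj F0)[r r0 /(_ _ C0)] /=.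
  by rewrite !subrr normr0; case; lra.
have [x [y [hx ox Fx]]] : exists x y, [/\ h1 * x + h2 * y = be,
    aff o x y = 0 & forall i, 0 <= aff (F i) x y].
  (* The objective changes sign between [(x1, y1)] and [(x0, y0)], both on the line; [t] is where it
     vanishes. *)
  pose t := aff o x0 y0 / (aff o x0 y0 - aff o x1 y1).
  have d0 : 0 < aff o x0 y0 - aff o x1 y1 by lra.
  have /andP[t0 t1] : 0 <= t <= 1.
    by rewrite divr_ge0 ?ler_pdivrMr //=; lra.
  exists (t * x1 + (1 - t) * x0), (t * y1 + (1 - t) * y0); split.
  - rewrite -[RHS](_ : t * be + (1 - t) * be = be); last by ring.
    by rewrite -{1}hx1 -hx0; ring.
  - by rewrite aff_convex /t; field; rewrite gt_eqF.
  - by move=> i; rewrite aff_convex; have := F0 i; have := F1 i; nra.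
have [|g1 [g2 gC]] := separate_point Fx; first by rewrite ox.
(* [w] and [h] are both orthogonal to [d], hence proportional in the plane. *)
pose d1 := x0 - x; pose d2 := y0 - y.
have gd : 0 < g1 * d1 + g2 * d2 := gC _ C0.
have od : 0 < o.1.1 * d1 + o.1.2 * d2.
  by move: ox ox0; rewrite /aff /d1 /d2; lra.
(* With this scaling [rho * g] and the objective grow equally along [d], so [w] vanishes there. *)
pose rho := (o.1.1 * d1 + o.1.2 * d2) / (g1 * d1 + g2 * d2).
have rho0 : 0 < rho by rewrite divr_gt0.
pose w1 := rho * g1 - o.1.1; pose w2 := rho * g2 - o.1.2.
have wd : w1 * d1 + w2 * d2 = 0.
  by rewrite /w1 /w2 /rho; field; rewrite gt_eqF.
have hd : h1 * d1 + h2 * d2 = 0 by rewrite /d1 /d2; lra.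
have wh : w1 * h2 = w2 * h1.
  have e1 : d1 * (w1 * h2 - w2 * h1) = 0.
    transitivity ((w1 * d1 + w2 * d2) * h2 - w2 * (h1 * d1 + h2 * d2)); first ring.
    by rewrite wd hd mul0r mulr0 subrr.
  have e2 : d2 * (w1 * h2 - w2 * h1) = 0.
    transitivity (w1 * (h1 * d1 + h2 * d2) - (w1 * d1 + w2 * d2) * h1); first ring.
    by rewrite wd hd mul0r mulr0 subrr.
  apply/eqP; rewrite -subr_eq0; apply/eqP.
  move/eqP: e1; rewrite mulf_eq0 => /orP[/eqP d10|/eqP//].
  move/eqP: e2; rewrite mulf_eq0 => /orP[/eqP d20|/eqP//].
  by move: gd; rewrite d10 d20 !mulr0 addr0 ltxx.
have [ga [w1E w2E]] : exists ga, w1 = ga * h1 /\ w2 = ga * h2.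
  have [h10|h10] := eqVneq h1 0.
    have h20 : h2 != 0 by move: hneq0; rewrite h10 eqxx.
    exists (w2 / h2); rewrite divfK // h10 mulr0; split => //.
    move/eqP: wh; rewrite h10 mulr0 mulf_eq0 => /orP[/eqP//|h20'].
    by rewrite h20' in h20.
  by exists (w1 / h1); rewrite divfK // mulrAC wh mulfK.
(* For [ga <= 0] the identity [op] below already makes [o] nonnegative on [C], and the zero
   multiplier suffices. *)
exists (fun i => Num.max ga 0 * la i) => [i|p Cp].
  by rewrite mulr_ge0 ?le_max ?lexx ?orbT // l0.
under eq_bigr do rewrite -mulrA.
rewrite -mulr_sumr.
have hp : 0 <= h1 * p.1 + h2 * p.2 - be by rewrite subr_ge0 beC.
have max0 : 0 <= Num.max ga 0 by rewrite le_max lexx orbT.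
have maxga : ga <= Num.max ga 0 by rewrite le_max lexx.
have op : aff o p.1 p.2 = rho * (g1 * (p.1 - x) + g2 * (p.2 - y))
    - ga * (h1 * p.1 + h2 * p.2 - be).
  transitivity (o.1.1 * (p.1 - x) + o.1.2 * (p.2 - y)).
    by move: ox; rewrite /aff; lra.
  have -> : o.1.1 = rho * g1 - ga * h1 by rewrite -w1E /w1; ring.
  have -> : o.1.2 = rho * g2 - ga * h2 by rewrite -w2E /w2; ring.
  by rewrite -hx; ring.
have := lF p.1 p.2; have : 0 <= rho * (g1 * (p.1 - x) + g2 * (p.2 - y)).
  by rewrite mulr_ge0 // ltW // gC.
rewrite op; nra.
Qed.

End planar_duality.

(** * Inner products and weak duality *)

Lemma dotv_mulmx (R : realType) (n : nat) (u v : 'cV[R]_n) :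
  dotv u v = (u^T *m v) ord0 ord0.
Proof. by rewrite mxE; apply: eq_bigr => i _; rewrite mxE. Qed.

Lemma dotvDr (R : realType) (n : nat) (u v w : 'cV[R]_n) :
  dotv u (v + w) = dotv u v + dotv u w.
Proof. by rewrite !dotv_mulmx mulmxDr mxE. Qed.

Lemma dotvZr (R : realType) (n : nat) (k : R) (u v : 'cV[R]_n) :
  dotv u (k *: v) = k * dotv u v.
Proof. by rewrite !dotv_mulmx -scalemxAr mxE. Qed.

Lemma dotv_sumr (R : realType) (n k : nat) (u : 'cV[R]_n) (w : 'I_k -> 'cV[R]_n) :
  dotv u (\sum_i w i) = \sum_i dotv u (w i).
Proof.
rewrite dotv_mulmx mulmx_sumr summxE.
by apply: eq_bigr => i _; rewrite dotv_mulmx.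
Qed.

(** Exhibits the Lagrangian as an affine function of [x], so that its lower bounds pass to the
    closed hull. *)
Lemma lagrangianE (R : realType) (m n : nat) (A : 'M[R]_(m, n)) (b l : 'cV[R]_m)
    (c x : 'cV[R]_n) :
  dotv c x + dotv l (b - A *m x) = dotv l b + dotv (c - A^T *m l) x.
Proof.
rewrite dotvDr -scaleN1r dotvZr.
have -> : dotv (c - A^T *m l) x = dotv c x - dotv l (A *m x); last by ring.
rewrite !dotv_mulmx linearB /= mulmxBl trmx_mul trmxK -mulmxA.
by rewrite mxE [X in _ + X]mxE.
Qed.

Lemma continuous_dotv (R : realType) (n : nat) (u : 'cV[R]_n) :
  continuous (dotv u).
Proof.
apply: continuous_big => [|i _ x]; first exact: add_continuous.
exact: cvgMl_tmp (@coord_continuous R n 1 i ord0 x).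
Qed.

Lemma dotv_ge_closure_conv (R : realType) (n : nat) (X : set 'cV[R]_n)
    (u : 'cV[R]_n) (k : R) :
  (forall x, X x -> k <= dotv u x) ->
  forall x, closure (conv_hull X) x -> k <= dotv u x.
Proof.
move=> kX; pose H : set 'cV[R]_n := [set x | k <= dotv u x].
have Hclosed : closed H.
  apply: ((continuous_closedP (dotv u)).1 (@continuous_dotv R n u)
    [set y | k <= y]); exact: closed_ge.
suff XH : conv_hull X `<=` H.
  by move=> x /(closure_subset XH); rewrite -((closure_id H).1 Hclosed).
move=> _ [N [w [p [w0 w1 Xp ->]]]]; rewrite /H /= dotv_sumr.
rewrite -[leLHS]mul1r -w1 mulr_suml; apply: ler_sum => i _.
by rewrite dotvZr ler_wpM2l // kX.
Qed.

Lemma weak_duality (R : realType) (m n : nat) (A : 'M[R]_(m, n)) (b : 'cV[R]_m)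
    (c : 'cV[R]_n) (X : set 'cV[R]_n) :
  (lagrangian_dual_value A b c X <= closed_hull_value A b c X)%E.
Proof.
apply: ge_ereal_sup => _ [l l0 <-]; apply: le_ereal_inf_tmp => _ [x [Ax Xx] <-].
have lAx : dotv l (b - A *m x) <= 0.
  apply: sumr_le0 => i _; rewrite mulr_ge0_le0 //.
    by have := l0 i; rewrite mxE.
  by have := Ax i; rewrite !mxE subr_le0.
have dual_le y : X y ->
    (dual_fun A b c X l <= (dotv l b + dotv (c - A^T *m l) y)%:E)%E.
  by move=> Xy; rewrite -lagrangianE; apply: ereal_inf_lbound; exists y.
case E : (dual_fun A b c X l) dual_le => [g| |] dual_le; last by rewrite leNye.
- rewrite lee_fin; have gX y : X y -> g - dotv l b <= dotv (c - A^T *m l) y.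
    by move=> /dual_le; rewrite lee_fin; lra.
  by have := dotv_ge_closure_conv gX Xx; have := lagrangianE A b l c x; lra.
(* The dual value [+oo] is impossible: a point in the closure yields a convex combination, whose
   family is nonempty since its weights sum to 1, hence a point of [X]. *)
- case: (Xx setT) => [|y [[N [w [p [w0 w1 Xp _]]]] _]]; first exact: filterT.
  case: N w p w0 w1 Xp => [w p _|N w p _ _ Xp].
    by rewrite big_ord0 => /eqP; rewrite eq_sym oner_eq0.
  by have := dual_le _ (Xp ord0).
Qed.

(** * Convex hulls and planar coordinates *)

Lemma conv_hull_sub (R : realType) (E : lmodType R) (X : set E) :
  X `<=` conv_hull X.
Proof.
move=> x Xx; exists 1%N, (fun=> 1), (fun=> x).
by split => //; rewrite big_ord1 ?scale1r.
Qed.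

Lemma conv_hull_convex (R : realType) (E : lmodType R) (X : set E) (x y : E) (t : R) :
  conv_hull X x -> conv_hull X y -> 0 <= t <= 1 ->
  conv_hull X (t *: x + (1 - t) *: y).
Proof.
move=> [k [w [p [w0 w1 Xp ->]]]] [k' [w' [p' [w'0 w'1 Xp' ->]]]] /andP[t0 t1].
(* The two families are concatenated, with weights scaled by [t] and [1 - t]. *)
pose W (i : 'I_(k + k')) := match fintype.split i with
  inl j => t * w j | inr j => (1 - t) * w' j end.
pose P (i : 'I_(k + k')) := match fintype.split i with
  inl j => p j | inr j => p' j end.
have spl j : fintype.split (lshift k' j) = inl j := unsplitK (inl j).
have spr j : fintype.split (rshift k j) = inr j := unsplitK (inr j).
exists (k + k')%N, W, P; split.
- by move=> i; rewrite /W; case: fintype.split => j; rewrite mulr_ge0 // subr_ge0.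
- rewrite big_split_ord /=.
  under eq_bigr do rewrite /W spl.
  under [X in _ + X]eq_bigr do rewrite /W spr.
  by rewrite -!mulr_sumr w1 w'1; ring.
- by move=> i; rewrite /P; case: fintype.split.
- rewrite big_split_ord /= !scaler_sumr; congr (_ + _); apply: eq_bigr => i _.
    by rewrite /W /P spl scalerA.
  by rewrite /W /P spr scalerA.
Qed.

(* For [n <= 1] the superfluous coordinates are discarded, so preimages of sets
   under [planar_col] are cylinders in the plane. *)
Definition planar_col (R : realType) (n : nat) (x y : R) : 'cV[R]_n :=
  \col_i if i == 0%N :> nat then x else y.

Lemma planar_col_surj (R : realType) (n : nat) (p : 'cV[R]_n) :
  (n <= 2)%N -> exists x y, p = planar_col n x y.
Proof.
case: n p => [|[|[|//]]] p _.
- by exists 0, 0; apply/colP => -[].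
- by exists (p ord0 ord0), 0; apply/colP => i; rewrite mxE !ord1.
- exists (p ord0 ord0), (p ord_max ord0); apply/colP => i; rewrite mxE.
  by case: i => [[|[|//]] i2] /=; congr (p _ _); exact: val_inj.
Qed.

Lemma planar_col_split (R : realType) (n : nat) (x y : R) :
  planar_col n x y = x *: planar_col n 1 0 + y *: planar_col n 0 1.
Proof.
apply/colP => i; rewrite !mxE.
by case: ifP => _; rewrite ?mulr1 ?mulr0 ?addr0 ?add0r.
Qed.

Lemma planar_col_convex (R : realType) (n : nat) (t x y x' y' : R) :
  planar_col n (t * x + (1 - t) * x') (t * y + (1 - t) * y') =
  t *: planar_col n x y + (1 - t) *: planar_col n x' y'.
Proof. by apply/colP => i; rewrite !mxE; case: ifP. Qed.

(** * Strong duality below the closed hull value *)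

(** In planar coordinates [F] holds the constraint slacks and [o] the objective minus [al]. The hull
    itself serves as [C]; its closure enters only through the radius [r]. *)
Lemma strong_duality (R : realType) (m n : nat) (A : 'M[R]_(m, n))
    (b : 'cV[R]_m) (c : 'cV[R]_n) (X : set 'cV[R]_n) (al : R) :
  (n <= 2)%N -> feasible A b X -> (al%:E < closed_hull_value A b c X)%E ->
  exists2 l, lev 0 l & forall x, X x -> al <= dotv c x + dotv l (b - A *m x).
Proof.
move=> n2 [z Xz Az] al_lt.
pose pc := @planar_col R n.
pose F i := ((A *m pc 1 0) i ord0, (A *m pc 0 1) i ord0, - b i ord0).
pose o := (dotv c (pc 1 0), dotv c (pc 0 1), - al).
have FE i x y : aff (F i) x y = (A *m pc x y) i ord0 - b i ord0.
  rewrite /aff /= /pc (planar_col_split n x y) mulmxDr -!scalemxAr.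
  rewrite (_ : forall M N : 'cV[R]_m, (x *: M + y *: N) i ord0 =
    x * M i ord0 + y * N i ord0); last by move=> M N; rewrite !mxE.
  by ring.
have oE x y : aff o x y = dotv c (pc x y) - al.
  by rewrite /aff /= /pc (planar_col_split n x y) dotvDr !dotvZr; ring.
have [x0 [y0 zE]] := planar_col_surj z n2; subst z.
have [||||l l0 lC] := @planar_duality R m F o
    [set p | conv_hull X (pc p.1 p.2)] x0 y0.
- move=> p q t Cp Cq t01 /=.
  by rewrite /pc planar_col_convex; exact: conv_hull_convex.
- exact: conv_hull_sub.
- by move=> i; rewrite FE subr_ge0; exact: Az.
- move=> x y Fxy oxy; have : ~ closure (conv_hull X) (pc x y).
    move=> Xxy; move: oxy; rewrite oE; apply/negP; rewrite -ltNge subr_gt0.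
    rewrite -lte_fin (lt_le_trans al_lt) //; apply: ereal_inf_lbound.
    by exists (pc x y) => //; split => // i; rewrite -subr_ge0 -FE.
  (* Balls of column vectors are entrywise, so a hull point within [r] in both coordinates would lie
     in the neighbourhood [B] that misses the hull. *)
  move=> /existsNP[B /not_implyP[/nbhs_ballP[r /= r0 rB] noB]].
  exists r => // p Cp; apply: contrapT => /not_orP[/negP + /negP].
  rewrite -!ltNge => px py; apply: noB; exists (pc p.1 p.2); split => //.
  apply: rB; split => // i j; rewrite /ball /= !mxE.
  by case: ifP => _; rewrite distrC.
exists (\col_i l i) => [i|x Xx]; first by rewrite !mxE.
have [x1 [y1 xE]] := planar_col_surj x n2; subst x.
have := lC (x1, y1) (conv_hull_sub Xx); rewrite /= oE.
suff -> : \sum_i l i * aff (F i) x1 y1 =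
  - dotv (\col_i l i) (b - A *m planar_col n x1 y1) by rewrite /pc; lra.
by rewrite /dotv -sumrN; apply: eq_bigr => i _; rewrite FE !mxE; ring.
Qed.

Unset Implicit Arguments.

Theorem theorem1p3 (R : realType) (m n : nat)
    (A : 'M[R]_(m, n)) (b : 'cV[R]_m) (c : 'cV[R]_n) (X : set 'cV[R]_n)
    (Xint : forall x : 'cV[R]_n, X x -> x \is a mxOver Num.int)
    (n_le2 : (n <= 2)%N)
    (feas : feasible A b X) :
  lagrangian_dual_value A b c X = closed_hull_value A b c X.
Proof.
apply/eqP; rewrite eq_le weak_duality leNgt; apply/negP => gap.
have dual_ge (al : R) : (al%:E < closed_hull_value A b c X)%E ->
    (al%:E <= lagrangian_dual_value A b c X)%E.
  move=> /(strong_duality n_le2 feas)[l l0 lX].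
  apply: (@le_trans _ _ (dual_fun A b c X l)); last first.
    by apply: ereal_sup_ubound; exists l.
  by apply: le_ereal_inf_tmp => _ [x Xx <-]; rewrite lee_fin lX.
have v_fin : (closed_hull_value A b c X < +oo)%E.
  have [z Xz Az] := feas; apply: (@le_lt_trans _ _ (dotv c z)%:E); last exact: ltry.
  apply: ereal_inf_lbound; exists z => //; split => //.
  exact/subset_closure/conv_hull_sub.
(* Feasibility excludes [+oo] and the strict gap excludes [-oo]; at a real value [v], the levels
   [v - e] are certified for every [e > 0]. *)
case E : (closed_hull_value A b c X) gap v_fin dual_ge =>
  [v| |] // gap _ dual_ge; last by move: gap; rewrite ltNge leNye.
suff : (v%:E <= lagrangian_dual_value A b c X)%E by rewrite leNgt gap.
apply/lee_addgt0Pr => e e0; rewrite -leeBlDr // -EFinB.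
by apply: dual_ge; rewrite lte_fin ltrBlDr ltrDl.
Qed.
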